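(* Consider a chordal $(t,t)$-coloring of $K_n$. Then a strong cover exists, and for even $t\ge 2$ we have $\theta(K_n)\le 2$, while for odd $t\ge 3$ we have $\theta(K_n)\le 3$.
   Context: A $t$-coloring of $K_n$ is a representation of its edge set as a union $E(G_1)\cup\dots\cup E(G_t)$ of edge sets of $t$ graphs $G_1,\dots,G_t$ on $V(K_n)$; an edge may receive several colors. A clique of color $i$ is a vertex set spanning a complete subgraph of $G_i$. A $(t,k)$-coloring is a $t$-coloring in which every set of $k$ vertices (the whole vertex set if $n<k$) spans a clique of some color. It is chordal if every $G_i$ is chordal (no induced cycle of length at least $4$). A strong cover is a covering of all vertices by monochromatic cliques of pairwise different colors; $\theta(K_n)$ is the minimum number of cliques in a strong cover. *)

(* Defs.v *)
From mathcomp Require Import all_boot.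

Set Implicit Arguments.
Unset Strict Implicit.
Unset Printing Implicit Defensive.

Section Graphs.
Variable V : finType.
Implicit Types (e : rel V) (A : {set V}) (c : seq V).

Definition simple_graph e : Prop := symmetric e /\ irreflexive e.

Definition clique e A : bool :=
  [forall x in A, forall y in A, (x != y) ==> e x y].

(* The vertices of c are distinct, and the edges of e between them are exactly *)
(* the pairs of cyclically consecutive vertices of c.                          *)
Definition induced_cycle e c : Prop :=
  [/\ uniq c, 2 < size c
    & {in c &, forall x y, e x y = (y == next c x) || (x == next c y)}].

Definition chordal e : Prop := forall c, induced_cycle e c -> size c < 4.

End Graphs.

Section Colorings.
Variables (V : finType) (t : nat).
Implicit Types (G : 'I_t -> rel V) (S : {set 'I_t * {set V}}).

(* Edges may receive several colors: the graphs G i need not be disjoint. *)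
Definition coloring G : Prop :=
  (forall i, simple_graph (G i)) /\
  (forall x y, x != y -> exists i, G i x y).

Definition tk_coloring (k : nat) G : Prop :=
  [/\ coloring G,
      forall A : {set V}, #|A| = k -> exists i, clique (G i) A
    & #|V| < k -> exists i, clique (G i) [set: V]].

Definition chordal_coloring G : Prop := forall i, chordal (G i).

(* A pair (i, A) in S stands for a clique A of color i. *)
Definition strong_cover G S : bool :=
  [&& [forall p in S, clique (G p.1) p.2],
      [forall p in S, forall q in S, (p.1 == q.1) ==> (p == q)]
    & \bigcup_(p in S) p.2 == [set: V]].

(* A strong cover has at most t cliques, so t.+1 acts as the value "infinity" *)
(* taken when there is no strong cover.                                       *)
Definition theta G : nat := \big[minn/t.+1]_(S | strong_cover G S) #|S|.

Lemma strong_cover_card G S : strong_cover G S -> #|S| <= t.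
Proof.
case/and3P=> _ /forall_inP inj _.
rewrite -[t in _ <= t]card_ord -(card_in_imset (f := fst)) ?max_card //.
move=> p q pS qS /eqP pq; apply/eqP.
by have /forall_inP/(_ q qS)/implyP/(_ pq) := inj p pS.
Qed.

Lemma theta_le G S : strong_cover G S -> theta G <= #|S|.
Proof.
move=> covS; rewrite /theta -big_filter.
have: S \in [seq S <- index_enum {set 'I_t * {set V}} | strong_cover G S].
  by rewrite mem_filter covS mem_index_enum.
elim: (filter _ _) => // S1 s IHs; rewrite inE big_cons => /predU1P[-> | /IHs].
  exact: geq_minl.
by move=> le_s; apply: leq_trans le_s; apply: geq_minr.
Qed.

Lemma theta_attained G :
  (exists S, strong_cover G S) -> exists2 S, strong_cover G S & #|S| = theta G.
Proof.
case=> S0 cov0; have: theta G < t.+1.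
  exact: leq_trans (theta_le cov0) (strong_cover_card cov0).
rewrite /theta; elim/big_rec: _ => [|S m covS IHm]; first by rewrite ltnn.
by case: (leqP #|S| m) => _; [exists S | apply: IHm].
Qed.

End Colorings.

(* Main.v *)
(* If chordal graphs e and f together contain all edges, let h be the graph of *)
(* the non-edges of f. It is contained in e, and has no induced 2K_2 since f   *)
(* has no induced C_4; chordality of e then yields a clique of e meeting all   *)
(* edges of h, whose complement is a clique of f. Hence two colors that cover  *)
(* all edges give two cliques. Now pair up the colors. If each pair misses an  *)
(* edge, no color of these pairs has a clique containing all missed edges: for *)
(* even t this is a contradiction, and for odd t three colors remain, in one   *)
(* of which any given triple of vertices is a clique. The ends of the edges    *)
(* missed by two of them form a clique of the third one, and off it two colors *)
(* suffice.                                                                    *)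
Require Import Defs.
From mathcomp Require Import all_boot.
From mathcomp Require Import zify.

Set Implicit Arguments.
Unset Strict Implicit.
Unset Printing Implicit Defensive.

(** The clique of [e] meeting all edges of [h] comes from [clique_meeting_edges]. In a chordal
    graph, if every vertex of a clique has a neighbor in a connected set disjoint from it, then the
    whole clique has a common neighbor there ([connected_common_neighbor]). Adding that neighbor
    moves the clique into the component holding the edges of [h] still missed, until none is missed.
    [two_chordal_cliques] turns this into a cover by two cliques. The pairing of colors is
    [pair_cover_or_small_cliques]: each pair that fails spends two of the [t] vertices available for
    a monochromatic clique, namely the ends of an edge missed by the pair, and thereby excludes both
    its colors. [strong_cover3] handles the three colors left over for odd [t]. *)

Section ChordalGraphs.
Variable V : finType.
Implicit Types (e f h : rel V) (A B C D K S W : {set V}).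

(** * Cliques and induced cycles; common neighbors along paths *)

Lemma cliqueP e A :
  reflect {in A &, forall x y, x != y -> e x y} (clique e A).
Proof.
apply: (iffP forall_inP) => [cA x y xA yA | cA x xA].
  by move/forall_inP: (cA x xA) => /(_ y yA)/implyP.
by apply/forall_inP=> y yA; apply/implyP; apply: cA.
Qed.

Lemma clique_sub e A B : A \subset B -> clique e B -> clique e A.
Proof.
move=> /subsetP sAB /cliqueP cB; apply/cliqueP=> x y xA yA.
by apply: cB; apply: sAB.
Qed.

(** By symmetry and irreflexivity only pairs of positions [i < j] matter; such a pair is cyclically
    consecutive when [j] follows [i] or when they are the first and last positions. *)
Lemma induced_cycle_nth e x0 (c : seq V) :
    simple_graph e -> uniq c -> 2 < size c ->
    (forall i j, i < j < size c -> e (nth x0 c i) (nth x0 c j)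
       = (j == i.+1) || (i == 0) && (j == (size c).-1)) ->
  induced_cycle e c.
Proof.
move=> [e_sym e_irr] c_uniq c_gt2 ec; split=> // x y xc yc.
have nextE i : i < size c ->
    next c (nth x0 c i) = nth x0 c (if i.+1 == size c then 0 else i.+1).
  move=> lt_i; rewrite next_nth mem_nth // index_uniq //.
  case: c c_uniq c_gt2 ec xc yc lt_i => // a s _ _ _ _ _ /= lt_i.
  case: eqVneq => [[ls]|ne] /=; first by rewrite nth_default // ls.
  by apply: set_nth_default; lia.
have [i lt_i <-] : exists2 i, i < size c & nth x0 c i = x.
  by apply/nthP.
have [j lt_j <-] : exists2 j, j < size c & nth x0 c j = y.
  by apply/nthP.
have lt_next k : k < size c -> (if k.+1 == size c then 0 else k.+1) < size c.
  by case: ifP; lia.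
rewrite !nextE // !nth_uniq ?lt_next //.
case: (ltngtP i j) => [lt_ij | lt_ji | ->].
- by rewrite ec ?lt_ij //; do 2![case: ifP]; lia.
- by rewrite e_sym ec ?lt_ji //; do 2![case: ifP]; lia.
- by rewrite e_irr; case: ifP; lia.
Qed.

(* A shortest counterexample would close up with t and s to an induced cycle. *)
Lemma chordal_path_common_neighbor e t s x p :
    simple_graph e -> chordal e -> e t s -> path e x p ->
    t \notin x :: p -> s \notin x :: p -> e t x -> e s (last x p) ->
  exists2 z, z \in x :: p & e t z && e s z.
Proof.
move=> sg ch ets; have [e_sym e_irr] := sg.
move: {2}_.+1 (ltnSn (size p)) => m; elim: m => // m IHm in x p *.
rewrite ltnS => le_p ep tp sp etx.
(* Repeated vertices can be cut out, so the path may be assumed simple. *)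
suff main (q : seq V) : path e x q -> uniq (x :: q) -> t \notin x :: q ->
    s \notin x :: q -> e s (last x q) -> size q <= m ->
    exists2 z, z \in x :: q & e t z && e s z.
  case/shortenP: ep => q eq Uq sub_q esl.
  have szq : size q <= size p by apply: uniq_leq_size => //; case/andP: Uq.
  have sub z : z \in x :: q -> z \in x :: p.
    by rewrite !inE => /predU1P[-> | /sub_q ->]; rewrite ?eqxx ?orbT.
  have [||//||z /sub zp ez] := main q eq Uq.
  - by apply: contra tp => /sub.
  - by apply: contra sp => /sub.
  - exact: leq_trans szq le_p.
  by exists z.
move: q {p ep tp sp le_p} => p ep Up tp sp esl le_p.
have shorter y q : size q < size p -> path e y q -> {subset y :: q <= x :: p} ->
    e t y -> e s (last y q) -> exists2 z, z \in x :: p & e t z && e s z.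
  move=> ltq eq sub ety esy.
  have [||z /sub zp ez] := IHm y q (leq_trans ltq le_p) eq _ _ ety esy.
  - by apply: contra tp => /sub.
  - by apply: contra sp => /sub.
  by exists z.
case: (posnP (size p)) => [p0 | p_gt0].
  by rewrite (size0nil p0) /= in esl *; exists x; rewrite ?mem_head ?etx.
have dropE j : j < size p -> drop j p = nth x (x :: p) j.+1 :: drop j.+1 p.
  exact: drop_nth.
have takeE j : j <= size p -> last x (take j p) = nth x (x :: p) j.
  move=> le_j; rewrite (last_nth x) size_takel //.
  by rewrite -[x :: take j p]/(take j.+1 (x :: p)) nth_take.
(* A later neighbor of [t], an earlier neighbor of [s], or a chord of the path: each gives a
   strictly shorter path. In the chord search [i < j] is compared with position [j.+1], which skips
   consecutive vertices. *)
have [[j lt_j] /= etj | no_t] :=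
  pickP (fun j : 'I_(size p) => e t (nth x (x :: p) j.+1)).
  have := ep; rewrite -{1}(cat_take_drop j p) cat_path dropE //= => /and3P[_ _ ed].
  apply: (shorter _ _ _ ed _ etj); first by rewrite size_drop; lia.
    by move=> z; rewrite -dropE // => /mem_drop zp; rewrite inE zp orbT.
  by have := esl; rewrite -{1}(cat_take_drop j p) last_cat dropE.
have [[j lt_j] /= esj | no_s] :=
  pickP (fun j : 'I_(size p) => e s (nth x (x :: p) j)).
  have := ep; rewrite -{1}(cat_take_drop j p) cat_path => /andP[et _].
  apply: (shorter _ _ _ et _ etx); first by rewrite size_takel //; lia.
    by move=> z; rewrite !inE => /predU1P[-> | /mem_take ->]; rewrite ?eqxx ?orbT.
  by rewrite takeE // ltnW.
have [[[i lt_i] [j lt_j]] /= /andP[lt_ij eij] | no_c] :=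
  pickP (fun ij : 'I_(size p) * 'I_(size p) => (ij.1 < ij.2)
     && e (nth x (x :: p) ij.1) (nth x (x :: p) ij.2.+1)).
  have := ep; rewrite -{1}(cat_take_drop j p) cat_path dropE //= => /and3P[_ _ ed].
  have := ep; rewrite -{1}(cat_take_drop i p) cat_path => /andP[et _].
  apply: (shorter x (take i p ++ drop j p)) => //.
  - rewrite size_cat size_takel ?(ltnW lt_i) // size_drop.
    by rewrite -[ltnRHS](subnK (ltnW lt_j)) addnC ltn_add2l.
  - by rewrite cat_path et takeE ?(ltnW lt_i) // dropE //= eij.
  - move=> z; rewrite !inE mem_cat => /or3P[-> // | /mem_take -> | /mem_drop ->];
    by rewrite orbT.
  - have := esl; rewrite -{1}(cat_take_drop j p) !last_cat dropE //.
clear IHm shorter dropE takeE le_p.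
have ts : t != s by apply: contraTneq ets => ->; rewrite e_irr.
(* With no shortcut left this cycle has length [size p + 3], at least 4 because [p] is nonempty. *)
have : induced_cycle e (t :: rcons (x :: p) s).
  apply: (@induced_cycle_nth _ x) => //.
  - by rewrite cons_uniq rcons_uniq Up sp mem_rcons inE negb_or ts tp.
  - by rewrite /= size_rcons.
  have sz : size (t :: rcons (x :: p) s) = (size p).+3 by rewrite /= size_rcons.
  have nthp k : k <= size p ->
      nth x (t :: rcons (x :: p) s) k.+1 = nth x (x :: p) k.
    by move=> le_k; rewrite [LHS]/= -rcons_cons nth_rcons /= ltnS le_k.
  have nths : nth x (t :: rcons (x :: p) s) (size p).+2 = s.
    by rewrite [LHS]/= nth_rcons ltnn eqxx.
  rewrite sz => i j /andP[lt_ij lt_j].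
  case: j lt_ij lt_j => // j lt_ij lt_j.
  have [-> | nj] := eqVneq j (size p).+1.
    rewrite nths; case: i lt_ij => [|i] lt_ij; first by rewrite /= ets; lia.
    rewrite nthp; last by lia.
    have [-> | ni] := eqVneq i (size p).
      by rewrite e_sym nth_last /= esl; lia.
    have lt_i : i < size p by lia.
    by have /= := no_s (Ordinal lt_i); rewrite e_sym => ->; lia.
  rewrite nthp; last by lia.
  case: i lt_ij => [|i] lt_ij.
    case: j nj lt_ij lt_j => [|j] nj lt_ij lt_j; first by rewrite /= etx.
    have lt_j' : j < size p by lia.
    by have /= -> := no_t (Ordinal lt_j'); lia.
  rewrite nthp; last by lia.
  case: j nj lt_ij lt_j => [|j] nj lt_ij lt_j; first by lia.
  have lt_j' : j < size p by lia.
  have [-> | ne] := eqVneq j i.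
    by rewrite (pathP x ep) /=; lia.
  have lt_i : i < size p by lia.
  have /= := no_c (Ordinal lt_i, Ordinal lt_j'); case: ltnP => /=; last by lia.
  by move=> _ ->; lia.
by move/ch; rewrite /= size_rcons; lia.
Qed.

(** * Connected sets and components *)

Definition restrict_rel e C : rel V := [rel x y | [&& e x y, x \in C & y \in C]].

Definition connected_in e C : Prop :=
  {in C &, forall x y, connect (restrict_rel e C) x y}.

Lemma restrict_path e C x p :
  path (restrict_rel e C) x p -> path e x p /\ {subset p <= C}.
Proof.
elim: p x => //= y p IHp x /andP[/and3P[exy xC yC] /IHp[-> sub]].
by rewrite exy; split=> // z; rewrite inE => /predU1P[-> | /sub].
Qed.

(** Take [c] in [C] with the most neighbors in [S]. If it misses [s], a shortest path in [C] from
    [c] to a neighbor of [s] has only its last vertex adjacent to [s]. For each neighbor [r] of [c]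
    in [S], the common neighbor of [r] and [s] on the path is that last vertex, which thus beats
    [c]. *)
Lemma connected_common_neighbor e C S :
    simple_graph e -> chordal e -> connected_in e C -> clique e S ->
    [disjoint C & S] -> C != set0 ->
    {in S, forall s, exists2 c, c \in C & e s c} ->
  exists2 c, c \in C & {in S, forall s, e s c}.
Proof.
move=> sg ch conC /cliqueP clS dis /set0Pn[c0 c0C] nbS.
have [c cC cmax] := arg_maxnP (fun c => #|[set s in S | e s c]|) c0C.
exists c => // s sS; apply/negPn/negP => nsc.
have [d dC esd] := nbS s sS.
have ex_p : exists n, [exists p : n.-tuple V,
    path (restrict_rel e C) c p && e s (last c p)].
  have /connectP[p pp dE] := conC c d cC dC.
  by exists (size p); apply/existsP; exists (in_tuple p); rewrite /= pp -dE.
case: (ex_minnP ex_p) => n /existsP[[p /= /eqP szp] /andP[pp esl]] minp {ex_p}.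
have [ep sub_p] := restrict_path pp.
have sub_cp : {subset c :: p <= C}.
  by move=> z; rewrite inE => /predU1P[-> | /sub_p].
have notC z : z \in S -> z \notin c :: p.
  move=> zS; apply: contraL zS => /sub_cp zC.
  by rewrite (disjointFr dis).
have last_only z : z \in c :: p -> e s z -> z = last c p.
  move=> zp esz; case/splitPl pE: {1}p / zp => [p1 p2 zE].
  have := pp; rewrite pE cat_path => /andP[pp1 _].
  have : n <= size p1.
    by apply: minp; apply/existsP; exists (in_tuple p1); rewrite /= pp1 zE.
  rewrite -szp pE size_cat -[leqRHS]addn0 leq_add2l leqn0.
  by move=> /nilP p20; rewrite p20 cats0.
have lC : last c p \in C by apply: sub_cp; apply: mem_last.
have := cmax _ lC; rewrite /= leqNgt => /negP; apply.
apply: proper_card; apply/properP; split; last first.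
  by exists s; rewrite !inE sS.
apply/subsetP=> r; rewrite !inE => /andP[rS erc]; rewrite rS /=.
have rs : r != s by apply: contraNneq nsc => <-.
have [z zp /andP[erz esz]] :=
  chordal_path_common_neighbor sg ch (clS r s rS sS rs) ep (notC r rS)
    (notC s sS) erc esl.
by rewrite -(last_only z zp esz).
Qed.

Definition component e D (x : V) : {set V} :=
  [set z | connect (restrict_rel e D) x z].

Lemma component_self e D (x : V) : x \in component e D x.
Proof. by rewrite inE connect0. Qed.

Lemma component_sub e D (x : V) : x \in D -> component e D x \subset D.
Proof.
move=> xD; apply/subsetP=> z; rewrite inE => /connectP[p pp ->].
have [_ sub_p] := restrict_path pp.
by have := mem_last x p; rewrite inE => /predU1P[-> | /sub_p].
Qed.

Lemma component_edge e D x u v :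
  u \in component e D x -> u \in D -> v \in D -> e u v ->
  v \in component e D x.
Proof.
rewrite [in X in X -> _]inE => xu uD vD euv; rewrite inE.
apply: connect_trans xu (connect1 _).
exact/and3P.
Qed.

Lemma component_connected e D x : symmetric e -> connected_in e (component e D x).
Proof.
move=> e_sym; set C := component e D x.
have conx z : z \in C -> connect (restrict_rel e C) x z.
  rewrite inE => /connectP[p pp ->]; elim/last_ind: p pp => [|p y IHp] //=.
  rewrite rcons_path last_rcons => /andP[pp /and3P[elp lD yD]].
  apply: connect_trans (IHp pp) (connect1 _).
  have lC : last x p \in C by rewrite inE; apply/connectP; exists p.
  by apply/and3P; split=> //; apply: component_edge elp.
move=> y z /conx xy /conx xz; apply: connect_trans xz.
rewrite sym_connect_sym // => u v /=.
by rewrite /restrict_rel /= e_sym [(u \in C) && _]andbC.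
Qed.

(** * A clique meeting all edges of a subgraph without induced 2K_2 *)

Definition no_induced_2K2 h : Prop :=
  forall u v x y, uniq [:: u; v; x; y] -> h u v -> h x y ->
    [|| h u x, h u y, h v x | h v y].

(* All the edges of h missed by a clique S lie in one component C of e - S, *)
(* because h has no induced 2K_2. Moving S towards C shrinks C.             *)
Lemma clique_meeting_edges_component e h C S :
    simple_graph e -> chordal e -> subrel h e -> no_induced_2K2 h ->
    connected_in e C -> clique e S -> [disjoint C & S] ->
    (forall u v, u \in C -> e u v -> (v \in C) || (v \in S)) ->
    (exists u v, [/\ u \in C, v \in C & h u v]) ->
  exists2 K, clique e K & forall x y, h x y -> (x \in K) || (y \in K).
Proof.
move=> sg ch sub_he h2K2; have [e_sym e_irr] := sg.
move: {2}_.+1 (ltnSn #|C|) => m; elim: m => // m IHm in C S *.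
rewrite ltnS => le_C conC clS dis clos [u [v [uC vC huv]]].
pose S1 := [set s in S | [exists d in C, e s d]].
have clS1 : clique e S1.
  by apply: clique_sub clS; apply/subsetP=> s; rewrite inE => /andP[].
have [c cC ec] : exists2 c, c \in C & {in S1, forall s, e s c}.
  apply: connected_common_neighbor => //.
  - by apply: disjointWr dis; apply/subsetP=> s; rewrite inE => /andP[].
  - by apply/set0Pn; exists u.
  - by move=> s; rewrite inE => /andP[_ /exists_inP[d]]; exists d.
have clK : clique e (c |: S1).
  apply/cliqueP=> x y; move/cliqueP: clS1 => clS1.
  rewrite !in_setU1 => /predU1P[-> | xS] /predU1P[-> | yS] ne.
  - by rewrite eqxx in ne.
  - by rewrite e_sym ec.
  - exact: ec.
  - exact: clS1.
have [cov | ] := boolP [forall x, forall y,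
    h x y ==> (x \in c |: S1) || (y \in c |: S1)].
  exists (c |: S1) => // x y.
  by move/forallP/(_ x)/forallP/(_ y)/implyP: cov.
rewrite negb_forall => /existsP[x]; rewrite negb_forall => /existsP[y].
rewrite negb_imply negb_or => /and3P[hxy xK yK].
(* By [clos], an edge leaving [C] ends in [S], hence in [S1]. *)
have outC a b : a \in C -> b \notin C -> b \notin c |: S1 -> ~~ e a b.
  move=> aC bC bK; apply: contra bK => eab; rewrite in_setU1 inE.
  have := clos a b aC eab; rewrite (negPf bC) /= => ->.
  by rewrite (introT exists_inP) ?orbT //; exists a; rewrite // e_sym.
have exy := sub_he _ _ hxy; have eyx : e y x by rewrite e_sym.
(* If [x] and [y] both lay outside [C], then by [outC] the edges [u v] and [x y] would form an
   induced 2K_2 of [h]. *)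
have [xC | xC] := boolP (x \in C); last first.
  have [yC | yC] := boolP (y \in C).
    by move/negP: (outC y x yC xC xK).
  have neC a b : a \in C -> b \notin C -> a != b.
    by move=> aC; apply: contraNneq => <-.
  have uv : u != v by apply: contraTneq (sub_he _ _ huv) => ->; rewrite e_irr.
  have xy : x != y by apply: contraTneq exy => ->; rewrite e_irr.
  have : uniq [:: u; v; x; y].
    by rewrite /= !inE !negb_or uv xy !neC.
  move/h2K2 => /(_ huv hxy) /or4P[] /sub_he;
  by move=> eab; exfalso; move: eab; apply/negP; apply: outC.
have yC : y \in C by apply: contraT => yC; move/negP: (outC x y xC yC yK).
(* Since [c] has joined the clique, the component of [x] in [D] is strictly smaller than [C]. *)
pose D := C :\ c.
have xD : x \in D.
  by rewrite !inE xC andbT; apply: contraNneq xK => ->; rewrite setU11.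
have yD : y \in D.
  by rewrite !inE yC andbT; apply: contraNneq yK => ->; rewrite setU11.
have sub_D := component_sub e xD.
apply: (IHm (component e D x) (c |: S1)) => //.
- apply: leq_trans le_C; apply: leq_ltn_trans (subset_leq_card sub_D) _.
  by rewrite /D [ltnRHS](cardsD1 c) cC.
- exact: component_connected.
- rewrite disjoint_sym; apply: disjointWr sub_D _.
  rewrite disjoint_sym disjoints_subset; apply/subsetP=> z.
  rewrite !inE negb_or => /andP[-> zC] /=.
  by rewrite (disjointFr dis zC).
- move=> a b aC' eab; have aD := subsetP sub_D a aC'.
  have aC : a \in C by case/setD1P: aD.
  have [bK | bK] := boolP (b \in c |: S1); first by rewrite orbT.
  have bC : b \in C by apply: contraT => bC; move/negP: (outC a b aC bC bK).
  rewrite (component_edge aC') // !inE bC andbT.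
  by apply: contraNneq bK => ->; rewrite setU11.
- exists x, y; split=> //; first exact: component_self.
  exact: component_edge (component_self _ _ _) xD yD exy.
Qed.

(** The shrinking process starts from the empty clique and a component of [e] containing an edge of
    [h]. *)
Lemma clique_meeting_edges e h :
    simple_graph e -> chordal e -> subrel h e -> no_induced_2K2 h ->
  exists2 K, clique e K & forall x y, h x y -> (x \in K) || (y \in K).
Proof.
move=> sg ch sub_he h2K2; have [e_sym _] := sg.
have [noh | ] := boolP [forall x, forall y, ~~ h x y].
  exists set0; first by apply/cliqueP=> x y; rewrite inE.
  by move=> x y hxy; move/forallP/(_ x)/forallP/(_ y)/negP: noh.
rewrite negb_forall => /existsP[x]; rewrite negb_forall => /existsP[y].
rewrite negbK => hxy.
apply: (@clique_meeting_edges_component e h (component e setT x) set0) => //.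
- exact: component_connected.
- by apply/cliqueP=> u v; rewrite inE.
- by rewrite disjoint_sym disjoints_subset sub0set.
- by move=> u v uC euv; rewrite (component_edge uC).
- exists x, y; split=> //; first exact: component_self.
  by apply: component_edge (component_self _ _ _) _ _ (sub_he _ _ hxy).
Qed.

(** * Two chordal graphs covering all edges *)

Lemma chordal_no_induced_C4 e u x v y :
    simple_graph e -> chordal e -> uniq [:: u; x; v; y] ->
    e u x -> e x v -> e v y -> e y u ->
  e u v || e x y.
Proof.
move=> sg ch Uc eux exv evy eyu; apply/negPn/negP; rewrite negb_or.
case/andP=> /negPf nuv /negPf nxy; have [e_sym e_irr] := sg.
suff /ch : induced_cycle e [:: u; x; v; y] by [].
apply: (@induced_cycle_nth _ u) => // i j /andP[].
case: j i => [|[|[|[|j]]]] // [|[|[|i]]] //= _ _;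
  by rewrite ?eux ?exv ?evy ?nuv ?nxy // e_sym eyu.
Qed.

(** Only edges inside [W] need be covered, because with three colors this is applied off a clique of
    the third. *)
Lemma two_chordal_cliques e f W :
    simple_graph e -> simple_graph f -> chordal e -> chordal f ->
    {in W &, forall x y, x != y -> e x y || f x y} ->
  exists A B, [/\ clique e A, clique f B & W \subset A :|: B].
Proof.
move=> sge sgf che chf cov.
pose h := [rel x y | [&& x \in W, y \in W, x != y & ~~ f x y]].
have sub_he : subrel h e.
  move=> x y /and4P[xW yW xy nf].
  by have := cov x y xW yW xy; rewrite (negPf nf) orbF.
have h2K2 : no_induced_2K2 h.
  have [f_sym f_irr] := sgf.
  move=> u v x y Uc /and4P[uW vW uv nuv] /and4P[xW yW xy nxy].
  apply/negPn/negP; rewrite !negb_or /= uW vW xW yW /=.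
  move: Uc; rewrite /= !inE !negb_or -!andbA.
  case/and5P=> _ ux uy vx /and3P[vy _ _].
  rewrite ux uy vx vy /= !negbK => /and4P[fux fuy fvx fvy].
  (* An induced 2K_2 of [h] on [u v] and [x y] is an induced 4-cycle [u x v y] of [f]. *)
  have := @chordal_no_induced_C4 f u x v y sgf chf _ fux.
  rewrite (f_sym x v) (f_sym y u) (negPf nuv) (negPf nxy) fvx fvy fuy /=.
  rewrite !inE !negb_or ux uv uy vy xy eq_sym vx /=.
  by move=> /(_ isT isT isT isT).
have [K clK covK] := clique_meeting_edges sge che sub_he h2K2.
exists K, (W :\: K); split=> //.
  apply/cliqueP=> x y /setDP[xW xK] /setDP[yW yK] xy.
  apply: contraT => nf; have := covK x y; rewrite (negPf xK) (negPf yK) /=.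
  by rewrite xW yW xy nf => /(_ isT).
by apply/subsetP=> x xW; rewrite !inE xW andbT orbN.
Qed.

End ChordalGraphs.

(** * From colorings to strong covers *)

Section StrongCovers.
Variables (V : finType) (t : nat) (G : 'I_t -> rel V).

Lemma strong_cover_family (I : {set 'I_t}) (F : 'I_t -> {set V}) :
    {in I, forall i, clique (G i) (F i)} -> \bigcup_(i in I) F i = setT ->
  exists2 S, strong_cover G S & #|S| <= #|I|.
Proof.
move=> clF covF; exists [set (i, F i) | i in I]; last exact: leq_imset_card.
apply/and3P; split.
- by apply/forall_inP=> _ /imsetP[i iI ->]; apply: clF.
- apply/forall_inP=> _ /imsetP[i iI ->]; apply/forall_inP=> _ /imsetP[j jI ->].
  by apply/implyP=> /= /eqP ->.
- rewrite -covF; apply/eqP/setP=> x; apply/bigcupP/bigcupP.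
    by case=> _ /imsetP[i iI ->] xF; exists i.
  by case=> i iI xF; exists (i, F i) => //; apply: imset_f.
Qed.

Hypothesis hG : tk_coloring t G.

(** A smaller set is enlarged to exactly [t] vertices, unless there are fewer than [t] in all; then
    the whole vertex set is a clique of some color. *)
Lemma small_set_clique (A : {set V}) : #|A| <= t -> exists i, clique (G i) A.
Proof.
case: hG => _ big small le_A.
have [/small[i cl] | le_t] := ltnP #|V| t.
  by exists i; apply: clique_sub cl; apply: subsetT.
suff [B sAB /big[i cl]] : exists2 B : {set V}, A \subset B & #|B| = t.
  by exists i; apply: clique_sub cl.
have [k lt_k] := ubnP (t - #|A|); elim: k => // k IHk in A le_A lt_k *.
move: le_A; rewrite leq_eqVlt => /predU1P[eqA | ltA]; first by exists A.
have [x xA] : exists x, x \notin A.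
  apply/existsP; rewrite -negb_forall; apply: contraL ltA => /forallP inA.
  by rewrite -leqNgt (leq_trans le_t) // -cardsT subset_leq_card //; apply/subsetP.
have cardxA : #|x |: A| = #|A|.+1 by rewrite cardsU1 xA.
have [|| B sAB cardB] := IHk (x |: A); rewrite ?cardxA //; first by lia.
by exists B => //; apply: subset_trans sAB; apply: subsetU1.
Qed.

(* If colors m.*2 and m.*2.+1 both miss an edge x y, the color of a clique on *)
(* x, y and T is neither of them.                                             *)
Lemma pair_cover_or_small_cliques m : m.*2 <= t ->
  (exists i j, i != j /\ forall x y, x != y -> G i x y || G j x y) \/
  (forall T : {set V}, #|T| + m.*2 <= t ->
     exists2 i : 'I_t, m.*2 <= i & clique (G i) T).
Proof.
elim: m => [_ | m IHm le_m].
  by right=> T; rewrite addn0 => /small_set_clique[i cl]; exists i.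
have lt_a : m.*2 < t by lia.
have lt_b : m.*2.+1 < t by lia.
pose a := Ordinal lt_a; pose b := Ordinal lt_b.
have [|[i [j ij]]|small] := IHm; [lia | by left; exists i, j |].
have [cov | ] := boolP [forall x, forall y, (x != y) ==> G a x y || G b x y].
  left; exists a, b; split; first by apply/eqP => /(congr1 val) /=; lia.
  by move=> x y; move/forallP/(_ x)/forallP/(_ y)/implyP: cov.
rewrite negb_forall => /existsP[x]; rewrite negb_forall => /existsP[y].
rewrite negb_imply negb_or => /and3P[xy nax nbx].
(* The bound for [m] leaves room for two more vertices than the bound for [m.+1]. *)
right=> T le_T; have [|i le_i cl] := small ([set x; y] :|: T).
  have := cardsU [set x; y] T; rewrite cards2 xy; lia.
exists i; last by apply: clique_sub cl; apply: subsetUr.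
have Gi : G i x y by apply: (cliqueP _ _ cl); rewrite // !inE eqxx ?orbT.
have ne (k : 'I_t) : ~~ G k x y -> (i : nat) != k.
  by apply: contraNneq => /val_inj <-.
have := ne a nax; have := ne b nbx; rewrite /=; lia.
Qed.

Hypothesis chG : chordal_coloring G.

Lemma two_colors_cover (W : {set V}) (i j : 'I_t) :
    {in W &, forall x y, x != y -> G i x y || G j x y} ->
  exists A B, [/\ clique (G i) A, clique (G j) B & W \subset A :|: B].
Proof.
by case: hG => -[sg _] _ _; apply: two_chordal_cliques.
Qed.

Lemma strong_cover2 (i j : 'I_t) :
    i != j -> (forall x y, x != y -> G i x y || G j x y) ->
  exists2 S, strong_cover G S & #|S| <= 2.
Proof.
move=> ij cov.
have [|A [B [clA clB sub]]] := @two_colors_cover setT i j.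
  by move=> x y _ _; apply: cov.
have [||S cS leS] :=
  @strong_cover_family [set i; j] (fun k => if k == i then A else B).
- move=> k; rewrite !inE => /orP[] /eqP ->; first by rewrite eqxx.
  by rewrite eq_sym (negPf ij).
- apply/eqP; rewrite -subTset; apply: subset_trans sub _.
  rewrite subUset; apply/andP; split.
    by apply: (bigcup_max i); rewrite ?inE ?eqxx.
  by apply: (bigcup_max j); rewrite ?inE ?eqxx ?orbT // eq_sym (negPf ij).
by exists S => //; rewrite cards2 ij in leS.
Qed.

(* The ends of the edges missed by both i and j are joined in color k to every *)
(* vertex, so they form a clique of color k.                                   *)
Lemma strong_cover3 (i j k : 'I_t) :
    uniq [:: i; j; k] ->
    (forall T : {set V}, #|T| <= 3 ->
       exists2 l, l \in [:: i; j; k] & clique (G l) T) ->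
  exists2 S, strong_cover G S & #|S| <= 3.
Proof.
rewrite /= !inE negb_or => /and3P[/andP[ij ik] jk _] cl3.
pose K := [set x | [exists y, [&& x != y, ~~ G i x y & ~~ G j x y]]].
have clK : clique (G k) K.
  apply/cliqueP=> x z; rewrite inE => /existsP[y /and3P[xy nix njx]] _ xz.
  (* The edge [x y] rules out [i] and [j] as the color of this triple, so [x z] has color [k]. *)
  have [|l lijk /cliqueP clT] := cl3 [set x; y; z].
    by rewrite setUC cardsU1 cards2; case: (_ \notin _); case: (_ != _).
  have Gxy : G l x y by apply: clT; rewrite // !inE eqxx ?orbT.
  have Gxz : G l x z by apply: clT; rewrite // !inE eqxx ?orbT.
  move: lijk; rewrite !inE => /or3P[] /eqP lE; rewrite lE in Gxy Gxz => //.
    by rewrite Gxy in nix.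
  by rewrite Gxy in njx.
have [|A [B [clA clB sub]]] := @two_colors_cover (~: K) i j.
  move=> x y; rewrite !inE => /existsPn/(_ y) + _ xy.
  by rewrite xy /= negb_and !negbK.
pose F l := if l == i then A else if l == j then B else K.
have Fj : F j = B by rewrite /F eqxx eq_sym (negPf ij).
have Fk : F k = K by rewrite /F ![k == _]eq_sym (negPf ik) (negPf jk).
have Fi : F i = A by rewrite /F eqxx.
have [||S cS leS] := @strong_cover_family [set i; j; k] F.
- by move=> l; rewrite !inE => /orP[/orP[]|] /eqP ->; rewrite ?Fi ?Fj ?Fk.
- apply/eqP; rewrite -subTset -(setUCr K) subUset.
  rewrite (bigcup_max k) ?Fk ?inE ?eqxx ?orbT //=.
  apply: subset_trans sub _; rewrite subUset.
  by rewrite (bigcup_max i) ?(bigcup_max j) ?Fi ?Fj ?inE ?eqxx ?orbT.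
exists S => //; apply: leq_trans leS _.
by rewrite setUC cardsU1 cards2; case: (_ \notin _); case: (_ != _).
Qed.

Lemma strong_cover_even : ~~ odd t ->
  exists2 S, strong_cover G S & #|S| <= 2.
Proof.
move=> t_even; have tE : t./2.*2 = t by rewrite even_halfK.
have [|[i [j [ij cov]]]|small] := @pair_cover_or_small_cliques t./2.
- by rewrite tE.
- exact: strong_cover2 cov.
(* All colors are paired, so even the empty set would need a color numbered at least [t]. *)
have [|i] := small set0; first by rewrite cards0 tE.
by rewrite tE leqNgt ltn_ord.
Qed.

Lemma strong_cover_odd : 3 <= t -> odd t ->
  exists2 S, strong_cover G S & #|S| <= 3.
Proof.
(* The pairs use up the first [t - 3] colors and leave exactly three. *)
move=> t_ge3 t_odd; set m := (t - 3)./2.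
have tE : t = m.*2 + 3 by rewrite /m; lia.
have [|[i [j [ij cov]]]|small] := @pair_cover_or_small_cliques m; first lia.
  by have [S cS leS] := strong_cover2 ij cov; exists S => //; apply: leqW.
have lt k : k < 3 -> m.*2 + k < t by lia.
pose col k (k3 : k < 3) := Ordinal (lt k k3).
apply: (@strong_cover3 (@col 0 isT) (@col 1 isT) (@col 2 isT)).
  by rewrite /= !inE -!val_eqE /= !eqn_add2l.
move=> T le_T; have [|l le_l cl] := small T; first by lia.
exists l => //; rewrite !inE -!val_eqE /=.
by have := ltn_ord l; lia.
Qed.

End StrongCovers.

Theorem theorem1p7 (t n : nat) (G : 'I_t -> rel 'I_n)
    (hG : tk_coloring t G) (hchordal : chordal_coloring G) :
  [/\ exists S : {set 'I_t * {set 'I_n}}, strong_cover G S,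
      2 <= t -> ~~ odd t -> theta G <= 2
    & 3 <= t -> odd t -> theta G <= 3].
Proof.
have even2 := strong_cover_even hG hchordal.
have odd3 := strong_cover_odd hG hchordal.
split=> [|_ et|t3 ot]; last first.
- by have [S /theta_le le_S] := odd3 t3 ot; apply: leq_trans.
- by have [S /theta_le le_S] := even2 et; apply: leq_trans.
have [t_gt1 | t_le1] := ltnP 1 t.
  have [ot | et] := boolP (odd t).
    have [|S cS _] := odd3 _ ot; last by exists S.
    by lia.
  by have [S cS _] := even2 et; exists S.
(* For [t <= 1] the empty set already yields a color, so [t = 1] and this only color carries every
   edge. *)
have [i _] : exists i, clique (G i) set0.
  by apply: (small_set_clique hG); rewrite cards0.
have cl : clique (G i) setT.
  apply/cliqueP=> x y _ _ xy; case: hG => -[_ /(_ x y xy)[j Gj]] _ _.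
  suff -> : i = j by [].
  by apply: ord_inj; have := ltn_ord i; have := ltn_ord j; lia.
have [||S cS _] := @strong_cover_family _ _ G [set i] (fun=> setT).
- by move=> j /set1P->.
- by rewrite big_set1.
by exists S.
Qed.
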